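(* Let $G=(V,E)$ be a finite simple undirected graph with $N=|V|$ nodes whose node set is partitioned into a set $\mathcal{C}$ of (nonempty) categories, let $A\in\mathcal{C}$ with $\mathrm{vol}(A)=\sum_{v\in A}\deg(v)>0$, let $\mathrm{w}:V\to(0,\infty)$ be known sampling weights, and let $S$ be a weighted independence sample of size $n$ from $V$ with weights $\mathrm{w}$. Define $$\widehat{k}_V=\frac{\sum_{v\in S}\frac{\deg(v)}{\mathrm{w}(v)}}{\mathrm{w}_{-1}(S)},\qquad \widehat{k}_A=\frac{\sum_{v\in S_A}\frac{\deg(v)}{\mathrm{w}(v)}}{\mathrm{w}_{-1}(S_A)},\qquad \widehat{f}^{\mathrm{vol}}_A=\frac{1}{\sum_{s\in S}\frac{\deg(s)}{\mathrm{w}(s)}}\cdot\sum_{s\in S}\left(\frac{1}{\mathrm{w}(s)}\sum_{v\in\mathcal{N}(s)}1_{\{v\in A\}}\right).$$ Then the weighted star estimator of category size $$|\widehat{A}| = N\cdot \widehat{f}^{\mathrm{vol}}_A\cdot\frac{\widehat{k}_V}{\widehat{k}_A}$$ is consistent for $|A|$, i.e. $|\widehat{A}|\to|A|$ in probability as $n\to\infty$.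
   Context: Weighted independence sampling (WIS): $X_1,X_2,\dots$ are i.i.d. random nodes (sampling with replacement) with $P(X_i=v)=\pi(v)=\mathrm{w}(v)/\sum_{u\in V}\mathrm{w}(u)$, and $S$ is the multiset $\{X_1,\dots,X_n\}$; all sums over sub-multisets of $S$ count multiplicity. $S_A=\{v\in S: v\in A\}$. For a multiset $X$ of nodes, $\mathrm{w}_{-1}(X)=\sum_{v\in X}\frac{1}{\mathrm{w}(v)}$. $\mathcal{N}(s)$ is the set of neighbors of $s$ in $G$ and $\deg(s)=|\mathcal{N}(s)|$. Any ratio whose denominator is zero is assigned the value $0$. $G$, $N$ and $\mathrm{w}$ are fixed. *)

(* Defs.v *)
From HB Require Import structures.
From mathcomp Require Import all_boot all_order all_algebra finmap.
From mathcomp Require Import all_classical all_reals all_analysis.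

Set Implicit Arguments.
Unset Strict Implicit.
Unset Printing Implicit Defensive.

Import Order.TTheory GRing.Theory Num.Theory.
Import numFieldNormedType.Exports.

Local Open Scope classical_set_scope.
Local Open Scope ring_scope.

Section Graph.
Context (V : finType) (e : rel V).

Definition neighbors (s : V) : {set V} := [set v | e s v]%SET.

Definition deg (s : V) : nat := #|neighbors s|.

Definition vol (A : {set V}) : nat := (\sum_(v in A) deg v)%N.

End Graph.

(* A multiset of nodes is represented by a sequence, so that a sum over
   [v <- S] counts multiplicities. Division by zero in a field returns 0, which
   is the convention used below for ratios with a zero denominator. *)
Section Estimators.
Context (R : realType) (V : finType) (e : rel V) (w : V -> R).

Definition w_inv (S : seq V) : R := \sum_(v <- S) (w v)^-1.

Definition restr (S : seq V) (A : {set V}) : seq V := [seq v <- S | v \in A].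

(* k_est S and k_est (restr S A) are the estimators of the mean degree over V
   and over A, respectively. *)
Definition k_est (S : seq V) : R :=
  (\sum_(v <- S) (deg e v)%:R / w v) / w_inv S.

Definition fvol_est (A : {set V}) (S : seq V) : R :=
  1 / (\sum_(s <- S) (deg e s)%:R / w s) *
  \sum_(s <- S) (1 / w s * \sum_(v in neighbors e s) (v \in A)%:R).

Definition star_size_est (A : {set V}) (S : seq V) : R :=
  #|V|%:R * fvol_est A S * (k_est S / k_est (restr S A)).

End Estimators.

Section Probability.
Context d (T : measurableType d) (R : realType) (P : probability T R).

Definition mutually_independent (V : Type) (X : nat -> T -> V) : Prop :=
  forall (J : {fset nat}) (B : nat -> set V),
    P (\bigcap_(i in [set` J]) (X i @^-1` B i)) =
    (\prod_(i <- J) P (X i @^-1` B i))%E.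

Definition node_prob (V : finType) (w : V -> R) (v : V) : R :=
  w v / \sum_(u : V) w u.

(* The finite type V carries the discrete sigma-algebra. *)
Record weighted_independence_sampling (V : finType) (w : V -> R)
    (X : nat -> T -> V) : Prop := {
  wis_measurable : forall i (B : set V), measurable (X i @^-1` B) ;
  wis_law : forall i v, P (X i @^-1` [set v]) = (node_prob w v)%:E ;
  wis_independent : mutually_independent X
}.

Definition sample (V : Type) (X : nat -> T -> V) (n : nat) (t : T) : seq V :=
  [seq X i t | i <- iota 0 n].

Definition cvg_in_probability (Y : nat -> T -> R) (c : R) : Prop :=
  forall eps : R, 0 < eps ->
    P [set t | eps <= `|Y n t - c|] @[n --> \oo] --> 0%E.

End Probability.

(* Main.v *)
(* All five sums entering the estimator are sums over the sample of fixed node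
   functions, and the estimator is a ratio in which a common factor 1/n cancels.
   So it is a fixed rational function of five sample means, continuous at the
   limiting means, and consistency follows from the weak law of large numbers
   and continuous mapping. Symmetry of the edge relation identifies the limit
   of the neighbour count with vol(A). As V is finite, the weak law needs no
   integration: Chebyshev's inequality is a finite sum over sample paths, each
   weighted by the product of its node probabilities. *)
Require Import Defs.
From mathcomp Require Import all_boot all_order all_algebra finmap.
From mathcomp Require Import all_classical all_reals all_analysis.
From mathcomp Require Import measurable_realfun ring.

Set Implicit Arguments.
Unset Strict Implicit.
Unset Printing Implicit Defensive.

Import Order.TTheory GRing.Theory Num.Theory.
Import numFieldNormedType.Exports.

Local Open Scope ring_scope.

(** * Finite union bound for a measure *)

Lemma measure_bigsetU_le d (T : measurableType d) (R : realType)
    (mu : {measure set T -> \bar R}) (I : Type) (r : seq I) (Q : pred I)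
    (F : I -> set T) :
  (forall i, Q i -> measurable (F i)) ->
  (mu (\big[setU/set0]_(i <- r | Q i) F i) <= \sum_(i <- r | Q i) mu (F i))%E.
Proof.
move=> mF; elim: r => [|i r IH]; first by rewrite !big_nil measure0.
rewrite !big_cons; case: ifP => // Qi.
apply: (le_trans (measureU2 _ _ _)); [exact: mF|exact: bigsetU_measurable|].
by rewrite leeD2l.
Qed.

(** * Second moments of a sum under a finite product distribution *)

Section ProductMoments.
Context (R : comRingType) (V : finType) (p h : V -> R) (n : nat).
Hypotheses (p_sum1 : \sum_v p v = 1) (h_mean0 : \sum_v p v * h v = 0).

(** Distributivity turns the sum over [f] into a product over coordinates of sums over [V]. Off the
    diagonal, coordinate [i] contributes the mean of [h], which is 0; on it, all other coordinates
    contribute total mass 1. *)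
Lemma sum_prod_pair (i j : 'I_n) :
  \sum_(f : {ffun 'I_n -> V}) (\prod_k p (f k)) * (h (f i) * h (f j)) =
  if i == j then \sum_v p v * h v ^+ 2 else 0.
Proof.
pose c (k : 'I_n) v :=
  p v * ((if k == i then h v else 1) * (if k == j then h v else 1)).
transitivity (\sum_(f : {ffun 'I_n -> V}) \prod_k c k (f k)).
  apply: eq_bigr => f _; rewrite !big_split /=; congr (_ * (_ * _)).
    by rewrite -big_mkcond big_pred1_eq.
  by rewrite -big_mkcond big_pred1_eq.
rewrite -bigA_distr_bigA (bigD1 i) //=; case: (eqVneq i j) => [ij|ij].
  subst j; rewrite [X in _ * X]big1 ?mulr1 => [|k /negPf ki].
    by apply: eq_bigr => v _; rewrite /c eqxx expr2.
  by rewrite /c ki; under eq_bigr do rewrite !mulr1.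
rewrite [X in X * _](_ : _ = 0) ?mul0r // -[RHS]h_mean0.
by apply: eq_bigr => v _; rewrite /c eqxx (negPf ij) mulr1.
Qed.

(** Variances of independent summands add: once the square is expanded, only the [n] diagonal pairs
    survive. *)
Lemma sum_prod_sqr :
  \sum_(f : {ffun 'I_n -> V}) (\prod_k p (f k)) * (\sum_i h (f i)) ^+ 2 =
  n%:R * \sum_v p v * h v ^+ 2.
Proof.
under eq_bigr => f _.
  rewrite expr2 big_distrlr mulr_sumr /=.
  under eq_bigr do rewrite mulr_sumr.
  over.
rewrite exchange_big /=; under eq_bigr do rewrite exchange_big /=.
under eq_bigr => i _.
  under eq_bigr do rewrite sum_prod_pair eq_sym.
  rewrite -big_mkcond big_pred1_eq.
  over.
by rewrite sumr_const card_ord mulr_natl.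
Qed.

End ProductMoments.

(** * Distribution of a sample through its paths *)

Section Sampling.
Context (R : realType) (V : finType) (w : V -> R).
Context d (T : measurableType d) (P : probability T R) (X : nat -> T -> V).
Hypothesis X_wis : weighted_independence_sampling P w X.

Local Open Scope classical_set_scope.

Definition path_event n (f : {ffun 'I_n -> V}) : set T :=
  [set t | forall i : 'I_n, X i t = f i].

Lemma path_eventE n (f : {ffun 'I_n -> V}) :
  path_event f = \bigcap_(i : 'I_n) (X i @^-1` [set f i]).
Proof. by apply/seteqP; split => t /= H i; [move=> _; exact: H|exact: H]. Qed.

Lemma measurable_path_event n (f : {ffun 'I_n -> V}) :
  measurable (path_event f).
Proof.
rewrite path_eventE; apply: fin_bigcap_measurable => // i _.
exact: (wis_measurable X_wis).
Qed.

Lemma prob_path_event n (f : {ffun 'I_n -> V}) :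
  P (path_event f) = (\prod_i node_prob w (f i))%:E.
Proof.
pose J := [fset i in iota 0 n]%fset.
have inJ k : (k \in J) = (k < n)%N by rewrite !inE mem_iota.
(* [B k] is the singleton of [f k] for [k] below [n] and everything beyond, which avoids choosing a
   default node. *)
pose B k : set V := [set v | forall i : 'I_n, i = k :> nat -> v = f i].
have := wis_independent X_wis J B.
have -> : \bigcap_(k in [set` J]) (X k @^-1` B k) = path_event f.
  apply/seteqP; split => t /= H.
    by move=> i; apply: (H i) => //=; rewrite inJ.
  by move=> k _ i ik; rewrite /= -ik.
move=> ->; rewrite -prodEFin.
have pJ : perm_eq J (index_iota 0 n).
  apply: uniq_perm; rewrite ?fset_uniq ?iota_uniq // => k.
  by rewrite inJ mem_index_iota.
rewrite (perm_big _ pJ) big_mkord; apply: eq_bigr => i _.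
rewrite -(wis_law X_wis i); congr (P _); apply/seteqP; split => t /=.
  exact.
by move=> Xi j /ord_inj ->.
Qed.

Lemma big_sample (h : V -> R) n t :
  \sum_(v <- sample X n t) h v = \sum_(i < n) h (X i t).
Proof.
by rewrite big_map -[n in iota 0 n]subn0 -/(index_iota 0 n) big_mkord.
Qed.

(** As [V] is finite, there are finitely many paths of length [n], so any event about the sample,
    however irregular, is measurable and can be bounded path by path. *)
Lemma sample_eventE (Q : set (seq V)) n :
  [set t | Q (sample X n t)] =
  \big[setU/set0]_(f : {ffun 'I_n -> V} | `[< Q (codom f) >]) path_event f.
Proof.
have samp t (f : {ffun 'I_n -> V}) : path_event f t -> sample X n t = codom f.
  by move=> tf; rewrite codomE /sample -val_enum_ord -map_comp; exact: eq_map.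
rewrite -bigcup_pred; apply/seteqP; split => t /=; last first.
  by move=> [f /asboolP Qf tf] /=; rewrite (samp _ f).
move=> Qt; pose f : {ffun 'I_n -> V} := [ffun i : 'I_n => X i t].
have tf : path_event f t by move=> i; rewrite ffunE.
by exists f => //; apply/asboolP; rewrite -(samp t).
Qed.

Lemma measurable_sample_event (Q : set (seq V)) n :
  measurable [set t | Q (sample X n t)].
Proof.
rewrite sample_eventE; apply: bigsetU_measurable => f _.
exact: measurable_path_event.
Qed.

Lemma measurable_fun_sample (g : seq V -> R) n :
  measurable_fun setT (fun t => g (sample X n t)).
Proof.
move=> _ B _; rewrite setTI.
exact: (measurable_sample_event (g @^-1` B)).
Qed.

Lemma prob_sample_event_le (Q : set (seq V)) n :
  (P [set t | Q (sample X n t)] <=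
   (\sum_(f : {ffun 'I_n -> V} | `[< Q (codom f) >])
     \prod_i node_prob w (f i))%:E)%E.
Proof.
rewrite sample_eventE; apply: (le_trans (measure_bigsetU_le _ _ _)).
  by move=> f _; exact: measurable_path_event.
by rewrite -sumEFin; apply: lee_sum => f _; rewrite -prob_path_event.
Qed.

End Sampling.

(** * Weak law of large numbers for node functions *)

Section LawOfLargeNumbers.
Context (R : realType) (V : finType) (w : V -> R).
Hypothesis w_gt0 : forall v, 0 < w v.
Context d (T : measurableType d) (P : probability T R) (X : nat -> T -> V).
Hypothesis X_wis : weighted_independence_sampling P w X.

Local Open Scope classical_set_scope.
Local Open Scope ring_scope.

Definition sample_mean (h : V -> R) n t : R :=
  n%:R^-1 * \sum_(v <- sample X n t) h v.

Definition node_mean (h : V -> R) : R := \sum_v node_prob w v * h v.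

(** The node [v0] witnesses that [V] is nonempty, so that the total weight is positive. *)
Lemma sum_node_prob (v0 : V) : \sum_v node_prob w v = 1.
Proof.
rewrite -mulr_suml divff // gt_eqF // (bigD1 v0) //= ltr_pwDl //.
by apply: sumr_ge0 => v _; exact: ltW.
Qed.

Lemma node_prob_ge0 v : 0 <= node_prob w v.
Proof. by rewrite divr_ge0 ?sumr_ge0 // => *; exact: ltW. Qed.

(** On a path that deviates by at least [eps], the squared centred sum is at least
    [(n.+1 * eps) ^+ 2]. Averaging their quotient over all paths gives the bound, by
    [sum_prod_sqr]. *)
Lemma sample_mean_chebyshev (v0 : V) (h : V -> R) (eps : R) n : 0 < eps ->
  (P [set t | (eps <= `|sample_mean h n.+1 t - node_mean h|)%R] <=
   (\sum_v node_prob w v * (h v - node_mean h) ^+ 2 / eps ^+ 2 /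
     n.+1%:R)%:E)%E.
Proof.
move=> eps0; set m := node_mean h; set N : R := n.+1%:R.
have N0 : 0 < N by rewrite ltr0n.
have p1 := sum_node_prob v0.
have h0 : \sum_v node_prob w v * (h v - m) = 0.
  under eq_bigr do rewrite mulrBr.
  by rewrite big_split /= sumrN -mulr_suml p1 mul1r subrr.
pose Q : set (seq V) := [set s | eps <= `|N^-1 * \sum_(v <- s) h v - m|].
apply: (le_trans (prob_sample_event_le X_wis Q _)); rewrite lee_fin.
have := sum_prod_sqr n.+1 p1 h0; rewrite -/N => sqr.
have -> : \sum_v node_prob w v * (h v - m) ^+ 2 / eps ^+ 2 / N =
    \sum_(f : {ffun 'I_n.+1 -> V}) (\prod_k node_prob w (f k)) *
      ((\sum_i (h (f i) - m)) ^+ 2 / (N * eps) ^+ 2).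
  under [RHS]eq_bigr do rewrite mulrA.
  rewrite -!mulr_suml sqr; field.
  by rewrite !gt_eqF.
rewrite [leLHS]big_mkcond /=; apply: ler_sum => f _.
have p0 : 0 <= \prod_i node_prob w (f i).
  by apply: prodr_ge0 => *; exact: node_prob_ge0.
case: asboolP => [|_]; last first.
  by rewrite mulr_ge0 // divr_ge0 ?sqr_ge0.
rewrite /Q /= codomE big_map big_enum (eq_bigl xpredT) // => Qf.
(* It remains to see that the factor multiplying the path weight is at least 1. *)
rewrite ler_peMr //.
rewrite ler_pdivlMr ?exprn_gt0 ?mulr_gt0 // mul1r.
rewrite -[leRHS]real_normK ?num_real //.
rewrite ler_sqr ?nnegrE ?mulr_ge0 ?(ltW eps0) ?(ltW N0) //.
rewrite -ler_pdivlMl // (le_trans Qf) //.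
rewrite -[N^-1 in leRHS]gtr0_norm ?invr_gt0 // -normrM.
rewrite sumrB sumr_const card_ord mulrBr -[m *+ _]mulr_natl mulKf //.
by rewrite gt_eqF.
Qed.

Lemma sample_mean_cvg (v0 : V) (h : V -> R) :
  cvg_in_probability P (sample_mean h) (node_mean h).
Proof.
(* The Chebyshev bound concerns size [n.+1]; the shift drops the empty sample. *)
move=> eps eps0; rewrite -(cvg_shiftS _ (nbhs (0%E : \bar R))).
pose s := \sum_v node_prob w v * (h v - node_mean h) ^+ 2 / eps ^+ 2.
apply: (@squeeze_cvge _ _ _ _ (cst 0%E) _ (fun n => (s * n.+1%:R^-1)%:E)).
- apply: nearW => n; rewrite measure_ge0 /=.
  by have := sample_mean_chebyshev v0 h n eps0; rewrite -mulr_suml.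
- exact: cvg_cst.
- apply: cvg_EFin; first exact: nearW.
  rewrite -[X in _ --> X](mulr0 s).
  by apply: cvgM; [exact: cvg_cst|exact: cvg_harmonic].
Qed.

End LawOfLargeNumbers.

(** * Continuous mapping for convergence in probability *)

Section ContinuousMapping.

Local Open Scope classical_set_scope.
Local Open Scope ring_scope.

(** Continuity at [c] yields a [delta] such that [g] moves by [eps] only if some coordinate deviates
    by at least [delta]; the union bound over the [m] coordinates then tends to 0. *)
Lemma cvg_in_probability_continuous d (T : measurableType d) (R : realType)
    (P : probability T R) m (Y : nat -> T -> 'rV[R]_m) (c : 'rV[R]_m)
    (g : 'rV[R]_m -> R) :
  (forall n j, measurable_fun setT (fun t => Y n t 0 j)) ->
  (forall n, measurable_fun setT (fun t => g (Y n t))) ->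
  {for c, continuous g} ->
  (forall j, cvg_in_probability P (fun n t => Y n t 0 j) (c 0 j)) ->
  cvg_in_probability P (fun n t => g (Y n t)) (g c).
Proof.
move=> mY mg g_cont Y_cvg eps eps0.
have [delta delta0 gP] : exists2 delta : R, 0 < delta &
    forall q : 'rV[R]_m, (forall j, `|q 0 j - c 0 j| < delta) ->
      `|g q - g c| < eps.
  have /cvgrPdist_lt/(_ _ eps0)/nbhs_ballP[delta delta0 H] := g_cont.
  exists delta => // q qc; rewrite distrC; apply: H; split => // i j.
  by rewrite ord1 /ball /= distrC.
have mdev (f : T -> R) (a l : R) : measurable_fun setT f ->
    measurable [set t | a <= `|f t - l|].
  move=> mf; rewrite -[X in measurable X]setTI.
  have : measurable_fun setT (fun t => `|f t - l|).
    by apply: measurableT_comp => //; exact: measurable_funB.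
  move=> /(_ measurableT _ (measurable_itv `[a, +oo[)).
  by rewrite preimage_itvcy.
apply: (@squeeze_cvge _ _ _ _ (cst 0%E) _
  (fun n => \sum_j P [set t | (delta <= `|Y n t 0%R j - c 0%R j|)%R])%E).
- apply: nearW => n; rewrite measure_ge0 /=.
  have mF j : measurable [set t | delta <= `|Y n t 0 j - c 0 j|].
    exact: (mdev (fun t => Y n t 0 j)).
  apply: le_trans (measure_bigsetU_le P _ (fun j _ => mF j)).
  apply: le_measure; rewrite ?inE.
  - exact: (mdev (fun t => g (Y n t))).
  - exact: bigsetU_measurable.
  rewrite -bigcup_pred => t /=; apply: contraPP => H; apply/negP.
  rewrite -ltNge; apply: gP => j; rewrite ltNge; apply/negP => Hj.
  by apply: H; exists j.
- exact: cvg_cst.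
- rewrite [X in _ --> X](_ : _ = \sum_(j < m) 0)%E; last by rewrite big1.
  apply: cvg_nnesum => j _; last exact: Y_cvg.
  by apply: nearW => n; exact: measure_ge0.
Qed.

End ContinuousMapping.

(** * The estimator as a rational function of five means, and its limit *)

Section StarEstimator.
Context (R : realType) (V : finType) (e : rel V) (w : V -> R) (A : {set V}).

(** Values are natural numbers so that totals over [V] become cardinalities and volumes. Membership
    in [A] is a factor, so sums over the restricted sample run over the whole sample. *)
Definition star_count (k : nat) (v : V) : nat :=
  nth 0%N [:: deg e v; \sum_(u in neighbors e v) (u \in A); 1;
              (v \in A) * deg e v; nat_of_bool (v \in A)]%N k.

Definition star_term (k : nat) (v : V) : R := (star_count k v)%:R / w v.

(** The three quotients are, in order, [fvol_est] and the mean degree estimators over [V] and over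
    [A]. *)
Definition star_ratio (q : 'rV[R]_5) : R :=
  let c k := q 0 (inord k) in
  #|V|%:R * (c 1%N / c 0%N) * ((c 0%N / c 2%N) / (c 3%N / c 4%N)).

(** Only quotients of coordinates occur, so [a] cancels, even where a denominator is 0. *)
Lemma star_ratio_scale (a : R) (q : 'rV[R]_5) :
  a != 0 -> star_ratio (a *: q) = star_ratio q.
Proof.
move=> a0; have aK x y : (a * x) / (a * y) = x / y.
  by rewrite -mulf_div divff // mul1r.
by rewrite /star_ratio !mxE !aK.
Qed.

Lemma star_size_est_sums (S : seq V) :
  star_size_est e w A S =
  star_ratio (\row_k \sum_(v <- S) star_term k v).
Proof.
rewrite /star_ratio !mxE !inordK // /star_size_est /fvol_est /k_est /w_inv.
rewrite div1r [_^-1 * _]mulrC /restr !big_filter /star_term /=.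
congr (_ * (_ / _) * (_ / _ / (_ / _))).
- by apply: eq_bigr => v _; rewrite div1r mulrC natr_sum.
- by apply: eq_bigr => v _; rewrite div1r.
- rewrite big_mkcond; apply: eq_bigr => v _; rewrite /star_count /=.
  by case: (v \in A); rewrite ?mul1n ?mul0n ?mul0r.
- rewrite big_mkcond; apply: eq_bigr => v _; rewrite /star_count /=.
  by case: (v \in A); rewrite ?div1r ?mul0r.
Qed.

Lemma star_ratio_continuous (q : 'rV[R]_5) :
  (forall k : 'I_5, q 0 k != 0) -> {for q, continuous star_ratio}.
Proof.
move=> q0; rewrite /continuous_at /star_ratio.
have qk (k : 'I_5) : (x 0 k @[x --> nbhs q] --> q 0 k)%classic.
  exact: coord_continuous.
have qV (k l : 'I_5) :
    (x 0 k / x 0 l @[x --> nbhs q] --> q 0 k / q 0 l)%classic.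
  by apply: cvgM => //; exact: cvgV.
apply: (@cvgM _ _ (nbhs q)).
  by apply: (@cvgM _ _ (nbhs q) _ (cst #|V|%:R)); [exact: cvg_cst|exact: qV].
apply: (@cvgM _ _ (nbhs q)); first exact: qV.
(* The quotient for the mean degree over [A] is itself a denominator, so its numerator must be
   nonzero too. *)
apply: (@cvgV _ _ (nbhs q)); last exact: qV.
by rewrite mulf_neq0 ?invr_eq0.
Qed.

Hypotheses (e_sym : symmetric e) (w_gt0 : forall v, 0 < w v).

(** Double counting: by symmetry of [e], each [u] in [A] is counted once for each of its
    neighbours. *)
Lemma sum_neighbors_in :
  (\sum_v \sum_(u in neighbors e v) (u \in A) = vol e A)%N.
Proof.
rewrite /vol; under eq_bigr do rewrite big_mkcond.
rewrite exchange_big [RHS]big_mkcond /=; apply: eq_bigr => u _.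
under eq_bigr do rewrite inE e_sym.
rewrite -big_mkcond /= sum_nat_const /deg /neighbors cardsE.
by case: (u \in A); rewrite ?muln1 ?muln0.
Qed.

(** The weight in [node_prob] cancels the division by [w v]: reweighting removes the sampling bias
    up to the total weight. *)
Lemma node_mean_div (h : V -> R) :
  node_mean w (fun v => h v / w v) = (\sum_v h v) / \sum_v w v.
Proof.
rewrite mulr_suml; apply: eq_bigr => v _.
by rewrite mulrC mulrA divfK // gt_eqF.
Qed.

Lemma node_mean_star_term (k : nat) : (k < 5)%N ->
  node_mean w (star_term k) =
  (nth 0%N [:: vol e [set: V]; vol e A; #|V|; vol e A; #|A|] k)%:R /
  \sum_v w v.
Proof.
move=> k5; rewrite node_mean_div -natr_sum; congr (_%:R / _).
case: k k5 => [|[|[|[|[|]]]]] //= _; rewrite /star_count /=.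
- by rewrite /vol; apply: eq_bigl => v; rewrite inE.
- exact: sum_neighbors_in.
- by rewrite sum1_card.
- rewrite /vol [RHS]big_mkcond; apply: eq_bigr => v _.
  by case: (v \in A); rewrite ?mul1n.
- by rewrite -sum1_card [RHS]big_mkcond.
Qed.

Hypothesis volA_gt0 : (0 < vol e A)%N.

Lemma vol_gt0_inhabited : exists v, v \in A.
Proof.
apply/set0Pn; apply: contraTneq volA_gt0 => ->.
by rewrite /vol big_set0.
Qed.

(** Provides the nonzero limits that continuity of the ratio requires: [volA_gt0] bounds the volume
    of [V] from below and makes [A] and [V] nonempty. *)
Lemma node_mean_star_term_gt0 (k : nat) : (k < 5)%N ->
  0 < node_mean w (star_term k).
Proof.
move=> k5; rewrite node_mean_star_term //.
have [v0 v0A] := vol_gt0_inhabited.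
have W_gt0 : 0 < \sum_v w v.
  by rewrite (bigD1 v0) //= ltr_pwDl // sumr_ge0 // => v _; exact: ltW.
rewrite divr_gt0 // ltr0n.
have volV_gt0 : (0 < vol e [set: V])%N.
  apply: leq_trans volA_gt0 _; rewrite /vol [leqLHS]big_mkcond.
  by rewrite big_set leq_sum // => v _; case: ifP.
have A_gt0 : (0 < #|A|)%N by apply/card_gt0P; exists v0.
have V_gt0 : (0 < #|V|)%N by apply/card_gt0P; exists v0.
by case: k k5 => [|[|[|[|[|]]]]].
Qed.

(** The total weight cancels in each quotient, leaving [#|V| * (vol A / vol V) * ((vol V / #|V|) /
    (vol A / #|A|))]. *)
Lemma star_ratio_node_mean :
  star_ratio (\row_k node_mean w (star_term k)) = #|A|%:R.
Proof.
have nz k : (k < 5)%N -> node_mean w (star_term k) != 0.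
  by move=> /node_mean_star_term_gt0/lt0r_neq0.
have := (nz 0%N isT, nz 1%N isT, nz 2%N isT, nz 3%N isT, nz 4%N isT).
rewrite /star_ratio !mxE !inordK // !node_mean_star_term //=.
rewrite !mulf_eq0 !negb_or.
(* Position 3 has the same numerator [vol e A] as position 1, so [x1] covers both. *)
move=> -[[[[/andP[x0 W0] /andP[x1 _]] /andP[x2 _]] _] /andP[x4 _]].
by field; rewrite x0 x1 x2 x4 -invr_eq0 W0.
Qed.

End StarEstimator.

(** * Consistency of the star estimator *)

Theorem mainTheorem6 (R : realType)
    (V : finType) (e : rel V) (e_sym : symmetric e) (e_irr : irreflexive e)
    (C : {set {set V}}) (C_part : finset.partition C [set: V]%SET)
    (A : {set V}) (A_in_C : A \in C) (volA_gt0 : (0 < vol e A)%N)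
    (w : V -> R) (w_gt0 : forall v, 0 < w v)
    (d : measure_display) (T : measurableType d) (P : probability T R)
    (X : nat -> T -> V) (X_wis : weighted_independence_sampling P w X) :
  cvg_in_probability P
    (fun n t => star_size_est e w A (sample X n t)) #|A|%:R.
Proof.
have [v0 _] := vol_gt0_inhabited volA_gt0.
pose Y n t : 'rV[R]_5 := \row_k sample_mean X (star_term e w A k) n t.
have estE n t : star_size_est e w A (sample X n t) = star_ratio V (Y n t).
  rewrite star_size_est_sums; case: n => [|n].
    (* The empty sums and the junk factor 0^-1 = 0 both give 0. *)
    congr star_ratio; apply/rowP => k.
    by rewrite !mxE /sample_mean invr0 mul0r big_nil.
  (* For a nonempty sample, sums and means differ by a nonzero factor, which [star_ratio]
     ignores. *)
  rewrite -(@star_ratio_scale _ V n.+1%:R^-1) ?invr_eq0 ?pnatr_eq0 //.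
  by congr star_ratio; apply/rowP => k; rewrite !mxE.
(* With the target written as [star_ratio] at the limiting means, continuous mapping applies. *)
rewrite -(star_ratio_node_mean e_sym w_gt0 volA_gt0).
under eq_fun do under eq_fun do rewrite estE.
apply: cvg_in_probability_continuous.
- move=> n j; under eq_fun do rewrite mxE.
  exact: (measurable_fun_sample X_wis
    (fun S => n%:R^-1 * \sum_(v <- S) star_term e w A j v)).
- move=> n; under eq_fun do rewrite -estE.
  exact: (measurable_fun_sample X_wis (star_size_est e w A)).
- apply: star_ratio_continuous => k; rewrite mxE.
  exact/lt0r_neq0/node_mean_star_term_gt0.
- move=> j; rewrite mxE; under eq_fun do under eq_fun do rewrite mxE.
  exact: sample_mean_cvg.
Qed.
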